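(* Let $\alpha,\beta$ be positive reals. For every integer $k\ge 2$, the polynomial $\overline{G}^{\alpha,\beta}_k(x)$ has degree $d_k:=\lfloor k/2\rfloor$ and has $d_k$ distinct positive real roots; collect them in the set $S_k=\{\zeta_{k,1},\ldots,\zeta_{k,d_k}\}$ indexed from smallest to largest. Then: (i) for each $i\ge 1$, the sequence $(\zeta_{k,i})_k$ (over those $k\ge 2$ with $d_k\ge i$) converges to $0$; (ii) for every $k\ge 2$, $S_{k+1}$ interlaces $S_k$, and $S_{k+2}$ interlaces $S_k$ from both sides; (iii) if $\alpha/\beta\le 2$, then for every $i\ge 0$ the sequence $(\zeta_{k,d_k-i})_k$ is strictly increasing and converges to $4$; (iv) if $\alpha/\beta>2$, then $(\zeta_{k,d_k})_k$ is strictly increasing and converges to $\frac{(\alpha/\beta)^2}{\alpha/\beta-1}$, and for every $i\ge 1$ the sequence $(\zeta_{k,d_k-i})_k$ is strictly increasing and converges to $4$.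
   Context: For positive real numbers $\alpha,\beta$, define numbers $g_{k,j}$ for integers $k\ge 0$ and $j$ by: $g_{0,0}=\alpha$, $g_{1,0}=\beta$, $g_{k,j}=0$ whenever $j<0$ or $j>\lfloor k/2\rfloor$, and $g_{k,j}=g_{k-1,j}+g_{k-2,j-1}$ for $k\ge 2$, $0\le j\le\lfloor k/2\rfloor$. The sign-alternating Gibonacci polynomials are $\overline{G}^{\alpha,\beta}_k(x)=\sum_{j=0}^{\lfloor k/2\rfloor}(-1)^j g_{k,j}\,x^{\lfloor k/2\rfloor-j}$; equivalently $\overline{G}^{\alpha,\beta}_0=\alpha$, $\overline{G}^{\alpha,\beta}_1=\beta$, $\overline{G}^{\alpha,\beta}_k(x)=x^{(k-1)\bmod 2}\overline{G}^{\alpha,\beta}_{k-1}(x)-\overline{G}^{\alpha,\beta}_{k-2}(x)$ for $k\ge2$. For finite sets of reals $X=\{x_1<\cdots<x_n\}$ and $Y=\{y_1<\cdots<y_m\}$: $X$ interlaces $Y$ from both sides if $m=n-1$ and $x_1<y_1<x_2<y_2<\cdots<y_{n-1}<x_n$; $X$ interlaces $Y$ from the right if $m=n$ and $y_1<x_1<y_2<x_2<\cdots<y_n<x_n$; $X$ interlaces $Y$ if either of these holds. Sequences indexed by $k$ in (iii),(iv) run over those $k\ge2$ for which the index is defined. *)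

(* Defs.v *)
From HB Require Import structures.
From mathcomp Require Import all_boot all_order all_algebra.
From mathcomp Require Import polyrcf.
From mathcomp Require Import all_classical all_reals all_analysis.

Set Implicit Arguments.
Unset Strict Implicit.
Unset Printing Implicit Defensive.

Import Order.TTheory GRing.Theory Num.Theory.
Import numFieldNormedType.Exports.

Local Open Scope ring_scope.

Section Gibonacci.
Variables (R : realType) (alpha beta : R).

Fixpoint gib_coef (k : nat) (j : int) : R :=
  if (j < 0) || (k./2%:Z < j) then 0
  else match k with
       | 0 => alpha
       | 1 => beta
       | (k2.+1 as k1).+1 => gib_coef k1 j + gib_coef k2 (j - 1)
       end.

Definition altgib (k : nat) : {poly R} :=
  \sum_(j < (k./2).+1) ((-1) ^+ j * gib_coef k j%:Z) *: 'X^(k./2 - j).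

(* [rootsR p] is the strictly increasing list of all real roots of p when     *)
(* p != 0, without multiplicity.                                              *)
Definition gib_roots (k : nat) : seq R := rootsR (altgib k).

(* The index i starts at 1, and the value is meaningful only when             *)
(* 1 <= i <= size (gib_roots k).                                              *)
Definition zeta (k i : nat) : R := (gib_roots k)`_i.-1.

End Gibonacci.

Section Interlacing.
Variable R : realType.

(* A finite set of reals is given by the increasing list of its elements.     *)
Definition interlaces_both (X Y : seq R) : Prop :=
  size X = (size Y).+1 /\
  forall i, (i < size Y)%N -> X`_i < Y`_i /\ Y`_i < X`_i.+1.

Definition interlaces_right (X Y : seq R) : Prop :=
  size X = size Y /\
  forall i, (i < size X)%N ->
    Y`_i < X`_i /\ ((i.+1 < size X)%N -> X`_i < Y`_i.+1).

Definition interlaces (X Y : seq R) : Prop :=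
  interlaces_both X Y \/ interlaces_right X Y.

Definition strictly_increasing_on (D : pred nat) (u : nat -> R) : Prop :=
  forall k l : nat, D k -> D l -> (k < l)%N -> u k < u l.

End Interlacing.

(* The k >= 2 for which zeta_{k, d_k - i} is defined, where d_k = k./2.       *)
Definition top_index (i : nat) : pred nat :=
  fun k => (2 <= k)%N && (1 <= k./2 - i)%N.

(* Main.v *)
Require Import Defs.
From HB Require Import structures.
From mathcomp Require Import all_boot all_order all_algebra.
From mathcomp Require Import polyrcf.
From mathcomp Require Import all_classical all_reals all_analysis.
From mathcomp Require Import zify ring lra.

Set Implicit Arguments.
Unset Strict Implicit.
Unset Printing Implicit Defensive.

Import Order.TTheory GRing.Theory Num.Theory.
Import numFieldNormedType.Exports.

Local Open Scope classical_set_scope.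
Local Open Scope ring_scope.

(** With [x = 4 cos^2 t], the recurrence gives
      [sin t (2 cos t)^(k mod 2) G_k(x)
         = (2 beta - alpha) sin(k t) cos t + alpha cos(k t) sin t],
    so at the nodes [t = m pi / k] the sign of [G_k] is [(-1)^m].  The
    intermediate value theorem then puts one root of [G_k] between consecutive
    nodes and one above the largest node, which accounts for all [k./2] roots
    and, since a node with fixed [m] tends to [4] and one with [k./2 - m] fixed
    tends to [0], for all limits but that of the largest root.  If
    [alpha / beta <= 2], then [G_k(4) > 0] confines the largest root below [4].
    Otherwise, writing [q = alpha / beta] and [c = q^2 / (q - 1)], the sequence
    [G_k(c)] is positive, decaying geometrically, whereas at any [y < c] close
    to [c] the growing mode of the recurrence enters with negative coefficient,
    so some [G_k(y)] is negative and the largest root exceeds [y].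
    Interlacing is the Sturm argument: at a root of [G_k], [G_(k+1)] and
    [G_(k-1)] have opposite signs, so the alternation of [G_(k-1)] along the
    roots of [G_k] propagates. *)

(** * Real roots located through sign alternation *)

Section RootLocation.
Variable R : realType.
Implicit Types (p : {poly R}) (a : nat -> R) (x : R).

Lemma mem_rootsR p x : p != 0 -> (x \in rootsR p) = root p x.
Proof. by move=> p0; rewrite -roots_on_rootsR. Qed.

Lemma sorted_rootsR p : sorted <%R (rootsR p).
Proof. exact: sorted_roots. Qed.

Lemma ltr_nth_rootsR p i j :
  (i < j)%N -> (j < size (rootsR p))%N -> (rootsR p)`_i < (rootsR p)`_j.
Proof.
move=> ij js; rewrite (lt_sorted_ltn_nth 0 (sorted_rootsR p)) ?inE //.
exact: ltn_trans js.
Qed.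

(** Each of the [n] gaps contains a root by the intermediate value theorem, and a polynomial of
    degree [n] has no others. *)
Lemma rootsR_alternating p n a :
    size p = n.+1 ->
    (forall j, (j < n)%N -> a j < a j.+1) ->
    (forall j, (j <= n)%N -> 0 < (-1) ^+ (n - j) * p.[a j]) ->
  size (rootsR p) = n /\
  forall j, (j < n)%N -> a j < (rootsR p)`_j /\ (rootsR p)`_j < a j.+1.
Proof.
move=> sp a_lt a_sg.
have p0 : p != 0 by rewrite -size_poly_eq0 sp.
have /choice [r rP] : forall j, exists x, (j < n)%N ->
    [/\ a j < x, x < a j.+1 & root p x].
  move=> j; case: (ltnP j n) => [jn|_]; last by exists 0.
  (* The exponents [n - j] and [n - j.+1] have odd sum, so multiplying the two sign conditions
     leaves one minus sign. *)
  have sg_neg : p.[a j] * p.[a j.+1] < 0.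
    have := mulr_gt0 (a_sg j (ltnW jn)) (a_sg j.+1 jn).
    by rewrite mulrACA -exprD -(subnSK jn) addSn addnn -signr_odd /= odd_double
      expr1 mulN1r oppr_gt0.
  have [x] := poly_ivtoo (ltW (a_lt j jn)) sg_neg.
  by rewrite in_itv => /andP[? ?] ?; exists x.
have r_lt i j : (i < j)%N -> (j < n)%N -> r i < r j.
  elim: j => // j IH; rewrite ltnS leq_eqVlt => /predU1P[<-|ij] jn.
    by have [_ + _] := rP i (ltnW jn); have [+ _ _] := rP i.+1 jn; lra.
  have := IH ij (ltnW jn); have [_ + _] := rP j (ltnW jn).
  by have [+ _ _] := rP j.+1 jn; lra.
have r_sorted : sorted <%R (mkseq r n).
  apply/(sortedP 0) => i; rewrite size_mkseq => iS.
  by rewrite !nth_mkseq ?r_lt // ltnW.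
have r_root : all (root p) (mkseq r n).
  apply/allP => x /mapP[j]; rewrite mem_iota add0n => /andP[_ jn] ->.
  by have [] := rP j jn.
have -> : rootsR p = mkseq r n.
  apply: lt_sorted_eq => // [|x]; first exact: sorted_rootsR.
  rewrite mem_rootsR //; apply/idP/idP => [px|]; last exact: (allP r_root).
  (* A further root would make [n.+1] distinct roots in degree [n]. *)
  apply: contraT => xN; suff : (size (x :: mkseq r n) < size p)%N.
    by rewrite /= size_mkseq sp ltnn.
  apply: max_poly_roots => //=; first by rewrite px.
  by rewrite xN (lt_sorted_uniq r_sorted).
rewrite size_mkseq; split=> // j jn; rewrite nth_mkseq //.
by have [] := rP j jn.
Qed.

(** All roots are real and simple, so [p] splits into linear factors; the [n - j] factors whose root
    exceeds [x] are the negative ones. *)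
Lemma sgr_horner_between_roots p n j x :
    size p = n.+1 -> 0 < lead_coef p -> size (rootsR p) = n -> (j <= n)%N ->
    (forall i, (i < j)%N -> (rootsR p)`_i < x) ->
    (forall i, (j <= i < n)%N -> x < (rootsR p)`_i) ->
  0 < (-1) ^+ (n - j) * p.[x].
Proof.
move=> sp lp sr jn lo hi.
have p0 : p != 0 by rewrite -size_poly_eq0 sp.
have -> : p = lead_coef p *: \prod_(z <- rootsR p) ('X - z%:P).
  apply: all_roots_prod_XsubC; first by rewrite sp sr.
    by apply/allP => y; rewrite mem_rootsR.
  by rewrite uniq_rootsE lt_sorted_uniq // sorted_rootsR.
rewrite hornerZ horner_prod mulrCA mulr_gt0 //.
rewrite (big_nth 0) sr (big_cat_nat (leq0n j) jn) //= mulrCA mulr_gt0 //.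
  rewrite big_nat; apply: prodr_gt0 => i /andP[_ ij].
  by rewrite hornerXsubC subr_gt0 lo.
rewrite -prodr_const_nat -big_split /= big_nat; apply: prodr_gt0 => i ij.
by rewrite hornerXsubC mulN1r opprB subr_gt0 hi.
Qed.

Lemma exists_horner_gt0 p b : 0 < lead_coef p -> exists2 x, b < x & 0 < p.[x].
Proof.
move=> lp; have [y yP] := poly_pinfty_gt_lc lp.
exists (Num.max (b + 1) y); first by rewrite lt_max ltrDl ltr01.
by apply: lt_le_trans lp (yP _ _); rewrite le_max lexx orbT.
Qed.

(** The nodes are the elements of [s] followed by a point [M] where [p] is positive. *)
Lemma interlaces_right_rootsR p (s : seq R) :
    size p = (size s).+1 -> 0 < lead_coef p -> sorted <%R s ->
    (forall j, (j < size s)%N -> 0 < (-1) ^+ (size s - j) * p.[s`_j]) ->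
  interlaces_right (rootsR p) s.
Proof.
move=> sp lp ss sg; have [M sM pM] := exists_horner_gt0 s`_(size s).-1 lp.
pose a j := if (j < size s)%N then s`_j else M.
have [|j js|j js|sz loc] := @rootsR_alternating p (size s) a.
- exact: sp.
- rewrite /a js; case: ltnP => js'; last by rewrite (_ : j = (size s).-1) //; lia.
  by rewrite (lt_sorted_ltn_nth 0 ss) ?inE.
- rewrite /a; case: ltnP => js'; first exact: sg.
  by rewrite (_ : (size s - j)%N = 0%N) ?mul1r //; lia.
split=> // i; rewrite sz => si; have [lo hi] := loc i si.
by rewrite /a si in lo hi; split=> // si'; rewrite si' in hi.
Qed.

(** The extra node 0 in front of [s] yields one more root, below the whole of [s]. *)
Lemma interlaces_both_rootsR p (s : seq R) :
    size p = (size s).+2 -> 0 < lead_coef p -> sorted <%R s ->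
    (forall j, (j < size s)%N -> 0 < s`_j) ->
    0 < (-1) ^+ (size s).+1 * p.[0] ->
    (forall j, (j < size s)%N -> 0 < (-1) ^+ (size s - j) * p.[s`_j]) ->
  interlaces_both (rootsR p) s.
Proof.
move=> sp lp ss s_gt0 sg0 sg.
(* The maximum keeps [M] above the node 0, also when [s] is empty. *)
have [M sM pM] := exists_horner_gt0 (Num.max 0 s`_(size s).-1) lp.
move: sM; rewrite gt_max => /andP[M0 sM].
pose a j := if j is i.+1 then if (i < size s)%N then s`_i else M else 0.
have [|j js|j js|sz loc] := @rootsR_alternating p (size s).+1 a.
- exact: sp.
- case: j js => [|j] js; rewrite /a; first by case: ltnP => // js'; apply: s_gt0.
  rewrite ltnS in js; rewrite js; case: ltnP => js'.
    by rewrite (lt_sorted_ltn_nth 0 ss) ?inE.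
  by rewrite (_ : j = (size s).-1) //; lia.
- case: j js => [|j] js; rewrite /a; first by rewrite subn0.
  rewrite subSS; case: ltnP => js'; first exact: sg.
  by rewrite (_ : (size s - j)%N = 0%N) ?mul1r //; lia.
split=> // i si; have [_] := loc i (ltnW si); have [+ _] := loc i.+1 si.
by rewrite /a si.
Qed.

End RootLocation.

(** Counted from the largest element, both kinds of interlacing give the same comparison; this
    yields the monotonicity in $k$. *)
Lemma interlaces_top (R : realType) (X Y : seq R) i :
  interlaces X Y -> (i < size Y)%N -> Y`_(size Y - i).-1 < X`_(size X - i).-1.
Proof.
move=> [[-> XY]|[sX XY]] iY.
  rewrite subSn ?(ltnW iY) //= -(@prednK (size Y - i)) ?subn_gt0 //.
  by have [] := XY (size Y - i).-1; first by lia.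
by rewrite sX; have [] := XY (size Y - i).-1; first by lia.
Qed.

(** * The nodes $4\cos^2(m\pi/k)$ and their limits *)

Section Nodes.
Variable R : realType.

Lemma sin_natpi m : sin (m%:R * pi) = 0 :> R.
Proof.
elim: m => [|m IH]; first by rewrite mul0r sin0.
by rewrite mulrSr mulrDl mul1r sinDpi IH oppr0.
Qed.

Lemma cos_natpi m : cos (m%:R * pi) = (-1) ^+ m :> R.
Proof.
elim: m => [|m IH]; first by rewrite mul0r cos0.
by rewrite mulrSr mulrDl mul1r cosDpi IH exprS mulN1r.
Qed.

Definition gib_node (k m : nat) : R := (2 * cos (m%:R * (pi / k%:R))) ^+ 2.

Lemma gib_angle_bounds k m : (m <= k./2)%N -> 0 <= (m%:R * (pi / k%:R) : R) <= pi / 2.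
Proof.
move=> mk; have pi0 := @pi_ge0 R.
case: k mk => [|k mk]; first by rewrite leqn0 => /eqP->; rewrite mul0r lexx divr_ge0.
rewrite mulr_ge0 ?divr_ge0 //= mulrCA ler_wpM2l //.
rewrite ler_pdivrMr ?ltr0n // mulrC ler_pdivlMr ?ltr0n // -natrM ler_nat.
by lia.
Qed.

Lemma gib_node_ge0 k m : 0 <= gib_node k m.
Proof. exact: sqr_ge0. Qed.

Lemma gib_node_le4 k m : gib_node k m <= 4.
Proof.
have := cos_le1 (m%:R * (pi / k%:R) : R); have := cos_geN1 (m%:R * (pi / k%:R) : R).
rewrite /gib_node; nra.
Qed.

Lemma gib_node_lt k m m' : (m < m')%N -> (m' <= k./2)%N ->
  gib_node k m' < gib_node k m.
Proof.
move=> mm' m'k; rewrite /gib_node.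
have /andP[lo1 hi1] := gib_angle_bounds m'k.
have /andP[lo2 hi2] := gib_angle_bounds (leq_trans (ltnW mm') m'k).
have pi0 := @pi_gt0 R; have k0 : (0 < k)%N by lia.
have lt_cos : cos (m'%:R * (pi / k%:R)) < cos (m%:R * (pi / k%:R)) :> R.
  rewrite ltr_cos ?in_itv /=; try (by apply/andP; split; lra).
  by rewrite ltr_pM2r ?ltr_nat // divr_gt0 // ltr0n.
have : 0 <= cos (m'%:R * (pi / k%:R)) :> R by apply: cos_ge0_pihalf; lra.
nra.
Qed.

Lemma cvg_div_nat (x : R) : (fun k : nat => x / k%:R) @ \oo --> (0 : R).
Proof.
rewrite -[X in _ --> X](mulr0 x); apply: cvgM; first exact: cvg_cst.
by rewrite -cvg_shiftS; exact: cvg_harmonic.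
Qed.

Lemma cvg_gib_node (v : nat -> nat) (l : R) :
    (fun k => (v k)%:R / k%:R : R) @ \oo --> l ->
  (fun k => gib_node k (v k)) @ \oo --> (2 * cos (l * pi)) ^+ 2.
Proof.
move=> vl; rewrite /gib_node expr2.
have cv : (fun k => 2 * cos ((v k)%:R * (pi / k%:R))) @ \oo --> 2 * cos (l * pi).
  apply: cvgM; first exact: cvg_cst.
  apply: (@continuous_cvg _ _ _ _ _ _ (@cos R)); first exact: continuous_cos.
  rewrite (_ : (fun k => _) = (fun k => (v k)%:R / k%:R * pi)).
    by apply: cvgM => //; exact: cvg_cst.
  by apply/funext => k; rewrite mulrA mulrAC.
under eq_fun do rewrite expr2.
exact: cvgM.
Qed.

Lemma cvg_gib_node_top i : (fun k => gib_node k i) @ \oo --> (4 : R).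
Proof.
rewrite (_ : 4 = (2 * cos (0 * pi)) ^+ 2); last by rewrite mul0r cos0; ring.
exact/cvg_gib_node/cvg_div_nat.
Qed.

Lemma cvg_gib_node_bottom i : (fun k => gib_node k (k./2 - i)) @ \oo --> (0 : R).
Proof.
rewrite (_ : 0 = (2 * cos (2^-1 * pi)) ^+ 2); last first.
  by rewrite [2^-1 * pi]mulrC cos_pihalf mulr0 expr0n.
apply: cvg_gib_node.
(* In $2i+1$ the summand 1 covers the loss in halving an odd $k$. *)
apply: (@squeeze_cvgr _ _ _ _ (fun k => 2^-1 - (i.*2.+1)%:R / 2 / k%:R) (fun=> 2^-1)).
- near=> k.
  have k0 : 0 < k%:R :> R by rewrite ltr0n; near: k; exists 1%N.
  have ki : (i.*2 <= k)%N by near: k; exists i.*2.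
  rewrite ler_pdivlMr // ler_pdivrMr // mulrBl divfK ?gt_eqF //.
  have lo : ((k <= (k./2 - i).*2 + i.*2.+1))%N by lia.
  have hi : ((k./2 - i).*2 <= k)%N by lia.
  move: lo hi; rewrite -!(ler_nat R) natrD -!muln2 !natrM => lo hi.
  by apply/andP; split; lra.
- rewrite -[X in _ --> X]subr0; apply: cvgB; first exact: cvg_cst.
  exact: cvg_div_nat.
- exact: cvg_cst.
Unshelve. all: by end_near. Qed.

End Nodes.

(** * Recurrence, degree and sign at 0 *)

Section Gibonacci.
Variables (R : realType) (alpha beta : R).
Local Notation g := (gib_coef alpha beta).
Local Notation G := (altgib alpha beta).
Local Notation H k x := ((G k).[x]).

Lemma gib_coef_out k (j : int) : (j < 0) || (k./2%:Z < j) -> g k j = 0.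
Proof. by case: k => [|[|k]] /= ->. Qed.

Lemma gib_coefSS k (j : nat) : (j <= (k./2).+1)%N ->
  g k.+2 j = g k.+1 j + g k (j%:Z - 1).
Proof. by move=> jk; rewrite [LHS]/= ltz_nat ltnNge jk. Qed.

Local Arguments gib_coef : simpl never.

Lemma altgib0 : G 0 = alpha%:P.
Proof. by rewrite /altgib big_ord1 expr0 mul1r alg_polyC. Qed.

Lemma altgib1 : G 1 = beta%:P.
Proof. by rewrite /altgib big_ord1 expr0 mul1r alg_polyC. Qed.

(** The coefficient recurrence splits the sum in two; shifting $j$ by one in the second produces the
    minus sign. The factor ['X] appears exactly when [k.+2./2] exceeds [k.+1./2]. *)
Lemma altgibSS k : G k.+2 = 'X^(~~ odd k) * G k.+1 - G k.
Proof.
rewrite {1}/altgib [(k.+2)./2]/=.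
under eq_bigr => j _.
  rewrite gib_coefSS ?mulrDr ?scalerDl; last by rewrite -ltnS.
  over.
rewrite big_split /=; congr (_ + _); last first.
  rewrite big_ord_recl /= gib_coef_out // mulr0 scale0r add0r -sumrN.
  apply: eq_bigr => j _; rewrite /bump add1n exprS mulN1r mulNr scaleNr subSS.
  by congr (- ((_ * g k _) *: _)); lia.
rewrite /altgib [(k.+1)./2]/= uphalf_half; case ok: (odd k) => /=.
  by rewrite expr0 mul1r.
rewrite big_ord_recr /= (gib_coef_out (j := (k./2).+1)).
  rewrite mulr0 scale0r addr0 expr1 mulr_sumr; apply: eq_bigr => j _.
  by rewrite -scalerAr -exprS subSn // -ltnS.
by rewrite /= uphalf_half ok ltz_nat.
Qed.

Lemma horner_altgibSS k x : H k.+2 x = x ^+ (~~ odd k) * H k.+1 x - H k x.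
Proof. by rewrite altgibSS !hornerE. Qed.

Hypotheses (alpha_gt0 : 0 < alpha) (beta_gt0 : 0 < beta).

Lemma altgib_size_lead k :
  size (G k) = (k./2).+1 /\ size (G k.+1) = (k.+1./2).+1 /\
  lead_coef (G k.+1) = beta.
Proof.
elim: k => [|k [sk [sk1 lk1]]].
  by rewrite altgib0 altgib1 !size_polyC !lead_coefC !gt_eqF.
have sX : size ('X^(~~ odd k) * G k.+1) = (k.+2./2).+1.
  rewrite mulrC size_mulXn; first by rewrite sk1 /= uphalf_half; lia.
  by rewrite -size_poly_eq0 sk1.
have lt : (size (- G k)%R < size ('X^(~~ odd k) * G k.+1)%R)%N.
  by rewrite sX size_polyN sk.
split=> //; rewrite altgibSS.
by rewrite size_polyDl // lead_coefDl // sX lead_coefM lead_coefXn mul1r lk1.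
Qed.

Lemma size_altgib k : size (G k) = (k./2).+1.
Proof. by have [] := altgib_size_lead k. Qed.

Lemma lead_coef_altgib k : (0 < k)%N -> lead_coef (G k) = beta.
Proof. by case: k => // k _; have [_ []] := altgib_size_lead k. Qed.

(** At 0 the two terms of the recurrence never cancel: for even [k] the first vanishes, for odd [k]
    both have the same sign. *)
Lemma altgib0_sign k : 0 < (-1) ^+ k./2 * H k 0.
Proof.
suff : 0 < (-1) ^+ k./2 * H k 0 /\ 0 < (-1) ^+ k.+1./2 * H k.+1 0 by case.
elim: k => [|k [hk hk1]].
  by rewrite altgib0 altgib1 !hornerC !expr0 !mul1r.
split=> //; rewrite horner_altgibSS; move: hk hk1.
rewrite /= uphalf_half exprS; case: (odd k) => /=.
  by rewrite add1n exprS expr0 !mul1r => ? ?; lra.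
by rewrite add0n expr1 mul0r => ? ?; lra.
Qed.

(** * Trigonometric formula and signs at the nodes *)

Lemma altgib_trig k (t : R) :
  sin t * ((2 * cos t) ^+ odd k * H k ((2 * cos t) ^+ 2)) =
  (2 * beta - alpha) * (sin (k%:R * t) * cos t) + alpha * (cos (k%:R * t) * sin t).
Proof.
(* The factor $(2\cos t)^{j \bmod 2}$ removes the dependence on parity: [F] satisfies the recurrence
   of $\sin(jt)$ and $\cos(jt)$. *)
pose F j := (2 * cos t) ^+ odd j * H j ((2 * cos t) ^+ 2); rewrite -/(F k).
have FSS j : F j.+2 = 2 * cos t * F j.+1 - F j.
  rewrite /F horner_altgibSS /=; case: (odd j) => /=; ring.
suff [] : sin t * F k = (2 * beta - alpha) * (sin (k%:R * t) * cos t) +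
                 alpha * (cos (k%:R * t) * sin t) /\
          sin t * F k.+1 = (2 * beta - alpha) * (sin (k.+1%:R * t) * cos t) +
                 alpha * (cos (k.+1%:R * t) * sin t) by [].
elim: k => [|k [hk hk1]].
  rewrite /F altgib0 altgib1 !hornerC mul0r sin0 cos0 !mul1r /=; split; ring.
split=> //; rewrite FSS mulrBr hk mulrCA hk1 !mulrSr !mulrDl mul1r !(sinD, cosD).
apply/eqP; rewrite -subr_eq0; apply/eqP.
set s := sin t; set c := cos t; set S := sin _; set C := cos _.
transitivity (((2 * beta - alpha) * c * S + alpha * s * C) * (c ^+ 2 + s ^+ 2 - 1)).
  ring.
by rewrite cos2Dsin2 subrr mulr0.
Qed.

Lemma altgib_node_sign k m : (0 < m <= k./2)%N -> 0 < (-1) ^+ m * H k (gib_node R k m).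
Proof.
move=> /andP[m0 mk]; have /andP[lo hi] := gib_angle_bounds R mk.
have k0 : (0 < k)%N by lia.
have pi0 := @pi_gt0 R.
have t0 : 0 < m%:R * (pi / k%:R) :> R by rewrite mulr_gt0 ?divr_gt0 ?ltr0n.
have := altgib_trig k (m%:R * (pi / k%:R)); rewrite -/(gib_node R k m).
have -> : k%:R * (m%:R * (pi / k%:R)) = m%:R * pi :> R.
  by field; rewrite pnatr_eq0 -lt0n.
rewrite sin_natpi cos_natpi mul0r mulr0 add0r => eH.
set t : R := m%:R * (pi / k%:R) in lo hi t0 eH *.
have s0 : 0 < sin t by apply: sin_gt0_pi; lra.
(* For odd [k], $m \le \lfloor k/2\rfloor$ gives $2m < k$, hence $t < \pi/2$; for even [k] the
   factor is 1 and $t = \pi/2$ does no harm. *)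
have c0 : 0 < (2 * cos t) ^+ odd k.
  case ok : (odd k); last by rewrite expr0.
  rewrite expr1 mulr_gt0 //; apply: cos_gt0_pihalf; apply/andP; split; first lra.
  rewrite /t mulrCA ltr_pM2l // ltr_pdivrMr ?ltr0n // mulrC ltr_pdivlMr ?ltr0n //.
  by rewrite -natrM ltr_nat; lia.
have {}eH : (2 * cos t) ^+ odd k * H k (gib_node R k m) = alpha * (-1) ^+ m.
  by apply: (mulfI (lt0r_neq0 s0)); rewrite eH; ring.
by rewrite -(pmulr_rgt0 _ c0) mulrCA eH mulrCA -expr2 sqrr_sign mulr1.
Qed.

(** * Root location and interlacing *)

Local Notation r := (gib_roots alpha beta).

(** The bound [K] is left free: 4 when $\alpha/\beta \le 2$, $c$ for the largest root when
    $\alpha/\beta > 2$, any large point where only the nodes matter. *)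
Lemma gib_roots_location k K : (0 < k)%N -> 4 <= K -> 0 < H k K ->
  size (r k) = k./2 /\
  forall j, (j < k./2)%N ->
    [/\ gib_node R k (k./2 - j) < (r k)`_j, (r k)`_j < K &
        (j.+1 < k./2)%N -> (r k)`_j < gib_node R k (k./2 - j.+1)].
Proof.
move=> k0 K4 HK; set n := k./2.
(* Nodes decrease in $m$, hence the index [n - j]. [K] replaces the node $m = 0$, where $\sin t = 0$
   and the formula gives no sign. *)
pose a j := if (j < n)%N then gib_node R k (n - j) else K.
have node_ltK m : (0 < m <= n)%N -> gib_node R k m < K.
  move=> /andP[m0 mn]; apply: lt_le_trans K4.
  exact: lt_le_trans (gib_node_lt R m0 mn) (gib_node_le4 R _ _).
have [|j jn|j jn|sz loc] := @rootsR_alternating R (G k) n a.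
- exact: size_altgib.
- rewrite /a jn; case: ltnP => jn'; first by apply: gib_node_lt; lia.
  by apply: node_ltK; lia.
- rewrite /a; case: ltnP => jn'; first by apply: altgib_node_sign; lia.
  by rewrite (_ : (n - j)%N = 0%N) ?mul1r //; lia.
split=> // j jn; have [lo hi] := loc j jn.
move: lo hi; rewrite {1}/a jn => lo; rewrite /a; case: ltnP => jn' hi.
  by split=> //; apply: lt_trans hi (node_ltK _ _); lia.
by split.
Qed.

Lemma exists_gib_bound k : (0 < k)%N -> exists2 K, 4 <= K & 0 < H k K.
Proof.
move=> k0; have lp : 0 < lead_coef (G k) by rewrite lead_coef_altgib.
by have [K /ltW ? ?] := exists_horner_gt0 4 lp; exists K.
Qed.

Lemma gib_roots_size_gt0 k : (0 < k)%N ->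
  size (r k) = k./2 /\ forall j, (j < k./2)%N -> 0 < (r k)`_j.
Proof.
move=> k0; have [K K4 HK] := exists_gib_bound k0.
have [sz loc] := gib_roots_location k0 K4 HK.
split=> // j jn; have [lo _ _] := loc j jn.
exact: le_lt_trans (gib_node_ge0 R _ _) lo.
Qed.

(** The invariant of the Sturm induction. *)
Definition sign_at_roots k := forall j, (j < k./2)%N ->
  0 < (-1) ^+ (k./2 - j) * H k.+1 (r k)`_j.

Lemma root_gib_roots k j : (0 < k)%N -> (j < k./2)%N -> H k (r k)`_j = 0.
Proof.
move=> k0 jk; apply/rootP; rewrite -mem_rootsR.
  by rewrite mem_nth // (gib_roots_size_gt0 k0).1.
by rewrite -size_poly_eq0 size_altgib.
Qed.

Lemma interlaces_succ_of_sign k : (0 < k)%N -> sign_at_roots k ->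
  if odd k then interlaces_both (r k.+1) (r k) else interlaces_right (r k.+1) (r k).
Proof.
move=> k0 sg; have [sz r_gt0] := gib_roots_size_gt0 k0.
have lp : 0 < lead_coef (G k.+1) by rewrite lead_coef_altgib.
have szS := size_altgib k.+1; rewrite /= uphalf_half in szS.
have sg0 := altgib0_sign k.+1; rewrite /= uphalf_half in sg0.
case: (odd k) szS sg0 => szS sg0.
  by apply: interlaces_both_rootsR; rewrite ?sz //; apply: sorted_rootsR.
by apply: interlaces_right_rootsR; rewrite ?sz //; apply: sorted_rootsR.
Qed.

(** At a root of [G k.+1] the recurrence leaves [- G k], whose sign follows from the number of roots
    of [G k] above that point, known from interlacing. *)
Lemma sign_at_roots_succ k : (0 < k)%N -> sign_at_roots k -> sign_at_roots k.+1.
Proof.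
move=> k0 sg j jk; have [sz _] := gib_roots_size_gt0 k0.
have inter := interlaces_succ_of_sign k0 sg.
rewrite horner_altgibSS root_gib_roots // mulr0 add0r mulrN.
have lp : 0 < lead_coef (G k) by rewrite lead_coef_altgib.
have r_le i i' : (i <= i')%N -> (i' < k./2)%N -> (r k)`_i <= (r k)`_i'.
  rewrite leq_eqVlt => /predU1P[-> //|ii' i'k].
  by apply/ltW/ltr_nth_rootsR; rewrite // sz.
rewrite /= uphalf_half in jk *; move: inter jk; case: (odd k) => -[szX XY] jk.
  have jk' : (j <= k./2)%N by rewrite -ltnS.
  rewrite add1n subSn // exprS mulN1r mulNr opprK.
  apply: sgr_horner_between_roots => // [|i ij|i /andP[ji ik]].
  - exact: size_altgib.
  - have ik : (i < k./2)%N by lia.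
    have jk1 : (j.-1 < size (r k))%N by rewrite sz; lia.
    have [_] := XY j.-1 jk1.
    rewrite prednK; last by lia.
    by apply: le_lt_trans; apply: r_le; lia.
  - have jk1 : (j < size (r k))%N by rewrite sz; lia.
    have [lt _] := XY j jk1.
    by apply: lt_le_trans lt _; apply: r_le.
rewrite add0n in jk *.
(* Here [j.+1] roots of [G k] lie below the point, so the exponent drops by one and absorbs the
   minus sign. *)
rewrite -(subnSK jk) exprS mulN1r mulNr opprK.
have jk1 : (j < size (r k.+1))%N by rewrite szX sz.
have [lo hi] := XY j jk1.
apply: sgr_horner_between_roots => // [|i ij|i /andP[ji ik]].
- exact: size_altgib.
- by apply: le_lt_trans lo; apply: r_le.
- by apply: lt_le_trans (hi _) _; [rewrite szX sz; lia | apply: r_le].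
Qed.

Lemma gib_sign_at_roots k : (0 < k)%N -> sign_at_roots k.
Proof.
(* For [k = 1] there are no roots and the claim is vacuous. *)
elim: k => // -[|k] IH _; first by [].
exact: sign_at_roots_succ (IH isT).
Qed.

Lemma gib_interlaces k : (0 < k)%N -> interlaces (r k.+1) (r k).
Proof.
move=> k0; have := interlaces_succ_of_sign k0 (gib_sign_at_roots k0).
by case: (odd k); [left | right].
Qed.

(** At a root of [G k], which is positive, [G k.+2] is a positive multiple of [G k.+1]. *)
Lemma gib_interlaces_both k : (0 < k)%N -> interlaces_both (r k.+2) (r k).
Proof.
move=> k0; have [sz r_gt0] := gib_roots_size_gt0 k0.
apply: interlaces_both_rootsR; rewrite ?sz.
- exact: size_altgib.
- by rewrite lead_coef_altgib.
- exact: sorted_rootsR.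
- exact: r_gt0.
- exact: altgib0_sign k.+2.
move=> j jk; rewrite horner_altgibSS root_gib_roots // subr0 mulrCA mulr_gt0 //.
  by rewrite exprn_gt0 ?r_gt0.
exact: gib_sign_at_roots.
Qed.

Lemma zeta_top_increasing i :
  strictly_increasing_on (top_index i) (fun k => zeta alpha beta k (k./2 - i)).
Proof.
move=> k l /andP[k2 ik] /andP[l2 il].
have step m : (1 < m)%N -> (0 < m./2 - i)%N ->
    zeta alpha beta m (m./2 - i) < zeta alpha beta m.+1 (m.+1./2 - i).
  move=> m2 im; have m0 := ltnW m2.
  have := interlaces_top (i := i) (gib_interlaces m0).
  rewrite (gib_roots_size_gt0 m0).1 (gib_roots_size_gt0 (ltn0Sn m)).1; apply.
  by lia.
elim: l {l2 il} => // l IH; rewrite ltnS leq_eqVlt => /predU1P[<-|kl].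
  exact: step.
apply: lt_trans (IH kl) _; apply: step; first by lia.
have := half_leq (ltnW kl); lia.
Qed.

(** At 4 the normalised recurrence has the double characteristic root 1, so its solution is linear
    in $k$, with slope $2\beta-\alpha \ge 0$. *)
Lemma altgib_at4_gt0 k : alpha / beta <= 2 -> 0 < H k 4.
Proof.
rewrite ler_pdivrMr // => ab.
suff [e _] : 2 ^+ odd k * H k 4 = k%:R * (2 * beta - alpha) + alpha /\
    2 ^+ odd k.+1 * H k.+1 4 = k.+1%:R * (2 * beta - alpha) + alpha.
  have : 0 < 2 ^+ odd k * H k 4.
    by rewrite e ltr_wpDl // mulr_ge0 // subr_ge0.
  by rewrite pmulr_rgt0 // exprn_gt0.
elim: k => [|k [hk hk1]].
  by rewrite altgib0 altgib1 !hornerC /= !mul1r; split; ring.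
split=> //; rewrite horner_altgibSS !mulrSr; move: hk hk1; rewrite !mulrSr /=.
by case: (odd k); rewrite /= ?expr0 ?expr1 => hk hk1; lra.
Qed.

(** * Values at $c$ and just below it when $q > 2$ *)

Local Notation q := (alpha / beta).
Local Notation c := (q ^+ 2 / (q - 1)).

(* At [c] the recurrence has the purely decaying solution of ratio [1 / (q - 1)]. *)
Lemma altgib_top k : 2 < q ->
  H k c = (if odd k then beta else alpha) / (q - 1) ^+ k./2.
Proof.
move=> q2; suff : H k c = (if odd k then beta else alpha) / (q - 1) ^+ k./2 /\
  H k.+1 c = (if odd k.+1 then beta else alpha) / (q - 1) ^+ k.+1./2 by case.
have aE : alpha = q * beta by rewrite divfK // gt_eqF.
have q1 : q - 1 != 0 by rewrite gt_eqF //; lra.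
elim: k => [|k [hk hk1]].
  by rewrite altgib0 altgib1 !hornerC /= !divr1.
split=> //; rewrite horner_altgibSS hk hk1 /= uphalf_half.
have Q0 : (q - 1) ^+ k./2 != 0 by rewrite expf_neq0.
move: (alpha / beta) aE q1 Q0 => Q -> q1 Q0.
by case: (odd k) => /=; rewrite ?add0n ?add1n ?exprS ?expr0; field; rewrite q1 Q0.
Qed.

(** $c - 4 = (q-2)^2/(q-1)$; this makes $c$ admissible as the bound [K]. *)
Lemma top_limit_ge4 : 2 < q -> 4 <= c.
Proof.
move=> q2; rewrite ler_pdivlMr; last by lra.
by have := sqr_ge0 (q - 2); lra.
Qed.

Lemma altgib_top_gt0 k : 2 < q -> 0 < H k c.
Proof.
move=> q2; rewrite altgib_top // divr_gt0 ?exprn_gt0 //; last by lra.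
by case: ifP.
Qed.

(* [y = P + 2 + 1 / P] makes [P] and [1 / P] the characteristic roots of the
   recurrence for the even-indexed values; the growing mode has negative
   coefficient because [P < q - 1]. *)
Lemma altgib_even_lt0 P : 1 < P -> P < q - 1 ->
  exists2 m, (0 < m)%N & H m.*2 (P + 2 + P^-1) < 0.
Proof.
move=> P1 Pq; set y := _ + P^-1; pose u m := H m.*2 y.
have P0 : P != 0 by rewrite gt_eqF //; lra.
have uSS m : u m.+2 = (P + P^-1) * u m.+1 - u m.
  rewrite /u !doubleS !horner_altgibSS /= odd_double /= /y; ring.
(* This combination cancels the decaying mode, so [w] is geometric with ratio [P]. *)
pose w m := u m.+1 - P^-1 * u m.
have wS m : w m.+1 = P * w m by rewrite /w uSS; field.
have w0 : w 0%N < 0.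
  rewrite /w /u horner_altgibSS altgib1 altgib0 !hornerC /= expr1.
  rewrite (_ : _ - _ = beta * (P + 1) / P * (P + 1 - q)); last first.
    by rewrite /y; field; rewrite P0 gt_eqF.
  rewrite pmulr_rlt0 ?divr_gt0 ?mulr_gt0 //; lra.
have w_le m : w m <= w 0%N.
  elim: m => // m IH; rewrite wS; nra.
(* If [u] were never negative, it would lose at least [- w 0] at each step, which is impossible. *)
case: (pselect (exists2 m, (0 < m)%N & u m < 0)) => // noneg.
have u_ge0 m : 0 <= u m.
  case: m => [|m]; first by rewrite /u altgib0 hornerC ltW.
  by rewrite leNgt; apply/negP => um; apply: noneg; exists m.+1.
have u_le m : u m <= alpha + m%:R * w 0%N.
  elim: m => [|m IH]; first by rewrite /u altgib0 hornerC mul0r addr0.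
  have -> : u m.+1 = w m + P^-1 * u m by rewrite /w subrK.
  have : P^-1 * u m <= u m.
    by rewrite ler_piMl // invf_le1 ?ltW //; lra.
  have := w_le m; rewrite mulrSr; lra.
have := archi_boundP (divr_ge0 (ltW alpha_gt0) (ltW (_ : 0 < - w 0%N))).
rewrite oppr_gt0 => /(_ w0); rewrite ltr_pdivrMr ?oppr_gt0 //.
set N := Num.bound _ => aN; have := u_le N; have := u_ge0 N; lra.
Qed.

(** * Limits of the roots *)

Lemma cvg_zeta_bottom i : (0 < i)%N ->
  (fun k => zeta alpha beta k i) @ \oo --> (0 : R).
Proof.
move=> i0; apply: (@squeeze_cvgr _ _ _ _ (fun=> 0) (fun k => gib_node R k (k./2 - i))).
(* This gives [i < k./2], so the root numbered [i] is not the largest and has a node above it. *)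
- near=> k; have ki : (i.*2.+2 <= k)%N by near: k; exists i.*2.+2.
  have k0 : (0 < k)%N by lia.
  have [K K4 HK] := exists_gib_bound k0.
  have [_ loc] := gib_roots_location k0 K4 HK.
  have ik : (i.-1 < k./2)%N by lia.
  have [lo _] := loc i.-1 ik; rewrite prednK // => hi.
  rewrite /zeta (le_trans (gib_node_ge0 R _ _) (ltW lo)) /= ltW // hi //; lia.
- exact: cvg_cst.
- exact: cvg_gib_node_bottom.
Unshelve. all: by end_near. Qed.

(** The node [i.+1] lies below the root. For $i > 0$ another node, at most 4, lies above; for $q \le
    2$ the bound is [K = 4]. *)
Lemma cvg_zeta_top i : ((0 < i)%N \/ q <= 2) ->
  (fun k => zeta alpha beta k (k./2 - i)) @ \oo --> (4 : R).
Proof.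
move=> iq; apply: (@squeeze_cvgr _ _ _ _ (fun k => gib_node R k i.+1) (fun=> 4)).
- near=> k; have ki : (i.*2.+2 <= k)%N by near: k; exists i.*2.+2.
  have k0 : (0 < k)%N by lia.
  have ik : ((k./2 - i).-1 < k./2)%N by lia.
  rewrite /zeta; case: iq => [i0|q2].
    have [K K4 HK] := exists_gib_bound k0.
    have [_ loc] := gib_roots_location k0 K4 HK.
    have [lo _ hi] := loc _ ik.
    rewrite (_ : i.+1 = (k./2 - (k./2 - i).-1)%N); last by lia.
    rewrite ltW //=; apply: le_trans (ltW (hi _)) (gib_node_le4 R _ _); lia.
  have [_ loc] := gib_roots_location k0 (lexx _) (altgib_at4_gt0 k q2).
  have [lo hi _] := loc _ ik.
  rewrite (_ : i.+1 = (k./2 - (k./2 - i).-1)%N); last by lia.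
  by rewrite !ltW.
- exact: cvg_gib_node_top.
- exact: cvg_cst.
Unshelve. all: by end_near. Qed.

(** Beyond its largest root a polynomial with positive leading coefficient is positive. *)
Lemma zeta_top_gt m y : (0 < m)%N -> H m.*2 y < 0 -> y < zeta alpha beta m.*2 m.
Proof.
move=> m0 Hy; rewrite ltNge; apply/negP => zy.
have k0 : (0 < m.*2)%N by rewrite double_gt0.
have [sz _] := gib_roots_size_gt0 k0; rewrite doubleK in sz.
move: zy; rewrite le_eqVlt => /predU1P[zy|zy].
  by move: Hy; rewrite -zy /zeta root_gib_roots ?doubleK ?ltxx //; lia.
have : 0 < (-1) ^+ (m - m) * H m.*2 y.
  apply: sgr_horner_between_roots => // [||i im|i].
  - by rewrite size_altgib doubleK.
  - by rewrite lead_coef_altgib.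
  - apply: le_lt_trans zy; rewrite /zeta; have : (i <= m.-1)%N by lia.
    rewrite leq_eqVlt => /predU1P[-> //|im'].
    by apply/ltW/ltr_nth_rootsR; rewrite // sz; lia.
  - by lia.
by rewrite subnn mul1r; lra.
Qed.

Lemma cvg_zeta_max : 2 < q -> (fun k => zeta alpha beta k k./2) @ \oo --> c.
Proof.
move=> q2; have c4 := top_limit_ge4 q2.
apply/cvgrPdist_le => e e0.
(* $P + 2 + 1/P$ equals $c$ at $P = q-1$; [d <= e] keeps it above $c - e$, and $d \le (q-2)/2$ keeps
   $P > 1$. *)
pose d := Num.min e ((q - 2) / 2); pose P := q - 1 - d.
have d0 : 0 < d by rewrite lt_min e0 /=; lra.
have de : d <= e by rewrite ge_min lexx.
have dq : d <= (q - 2) / 2 by rewrite ge_min lexx orbT.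
have P1 : 1 < P by rewrite /P; lra.
have Pq : P < q - 1 by rewrite /P; lra.
have [m m0 Hm] := altgib_even_lt0 P1 Pq.
have yc : c - e <= P + 2 + P^-1.
  have q1 : q - 1 != 0 by rewrite gt_eqF //; lra.
  have cE : c = (q - 1) + 2 + (q - 1)^-1 by move: q q1 => Q q1; field.
  have : (q - 1)^-1 <= P^-1 by rewrite lef_pV2 ?posrE; lra.
  by rewrite cE; rewrite /P; lra.
have zm := zeta_top_gt m0 Hm.
(* One good index [m.*2] suffices, by monotonicity and the upper bound $c$. *)
suff close k : (m.*2 < k)%N -> `|c - zeta alpha beta k k./2| <= e.
  by near=> k; apply: close; near: k; exists m.*2.+1.
move=> km; have k0 : (0 < k)%N by clear - km; lia.
have [_ loc] := gib_roots_location k0 c4 (altgib_top_gt0 k q2).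
have kh : ((k./2).-1 < k./2)%N by clear - km m0; lia.
have [_ hi _] := loc _ kh.
have := @zeta_top_increasing 0 m.*2 k; rewrite !subn0 doubleK => inc.
have {}inc : zeta alpha beta m.*2 m < zeta alpha beta k k./2.
  by apply: inc => //; apply/andP; clear - km m0; split; lia.
rewrite ger0_norm; rewrite /zeta in inc zm *; lra.
Unshelve. all: by end_near. Qed.

End Gibonacci.

(** * Degree, roots and the four assertions assembled *)

Theorem theorem2p3 (R : realType) (alpha beta : R)
    (alpha_gt0 : 0 < alpha) (beta_gt0 : 0 < beta) :
  (forall k : nat, (2 <= k)%N ->
     size (altgib alpha beta k) = (k./2).+1 /\
     size (gib_roots alpha beta k) = k./2 /\
     (forall x : R, x \in gib_roots alpha beta k -> 0 < x)) /\
  (forall i : nat, (1 <= i)%N ->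
     (fun k : nat => zeta alpha beta k i) @ \oo --> (0 : R)) /\
  (forall k : nat, (2 <= k)%N ->
     interlaces (gib_roots alpha beta k.+1) (gib_roots alpha beta k) /\
     interlaces_both (gib_roots alpha beta k.+2) (gib_roots alpha beta k)) /\
  (alpha / beta <= 2 ->
     forall i : nat,
       strictly_increasing_on (top_index i)
         (fun k : nat => zeta alpha beta k (k./2 - i)) /\
       (fun k : nat => zeta alpha beta k (k./2 - i)) @ \oo --> (4 : R)) /\
  (2 < alpha / beta ->
     (strictly_increasing_on (top_index 0)
        (fun k : nat => zeta alpha beta k k./2) /\
      (fun k : nat => zeta alpha beta k k./2) @ \oo -->
        ((alpha / beta) ^+ 2 / (alpha / beta - 1) : R)) /\
     (forall i : nat, (1 <= i)%N ->
        strictly_increasing_on (top_index i)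
          (fun k : nat => zeta alpha beta k (k./2 - i)) /\
        (fun k : nat => zeta alpha beta k (k./2 - i)) @ \oo --> (4 : R))).
Proof.
split=> [k k2|].
  have k0 := ltnW k2; have [sz r_gt0] := gib_roots_size_gt0 alpha_gt0 beta_gt0 k0.
  split; first exact: size_altgib.
  by split=> // x /(nthP 0)[j]; rewrite sz => jk <-; apply: r_gt0.
split; first by move=> i; exact: cvg_zeta_bottom.
split.
  move=> k k2; have k0 := ltnW k2.
  by split; [exact: gib_interlaces | exact: gib_interlaces_both].
split=> [q2 i|q2].
  by split; [exact: zeta_top_increasing | apply: cvg_zeta_top => //; right].
split; last first.
  move=> i i0.
  by split; [exact: zeta_top_increasing | apply: cvg_zeta_top => //; left].
split; last exact: cvg_zeta_max.
move=> k l kD lD kl.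
by have := zeta_top_increasing alpha_gt0 beta_gt0 kD lD kl; rewrite !subn0.
Qed.
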